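(* For every $A=[a_{j,k}]_{1\leq j\leq n,\,1\leq k\leq n}\in \mathbb{M}_n(\mathbb{K})$, $$\sigma(A)\subseteq \bigcup_{j,k=1,\ j\neq k}^n\{z\in\mathbb{K}: |z-a_{j,j}|\,|z-a_{k,k}|\leq h_j(A)h_k(A)\}$$ and $$\sigma(A)\subseteq \bigcup_{j,k=1,\ j\neq k}^n\{z\in\mathbb{K}: |z-a_{j,j}|\,|z-a_{k,k}|\leq v_j(A)v_k(A)\}.$$
   Context: $\mathbb{K}$ denotes a non-Archimedean valued field with valuation $|\cdot|$, that is, a field with a map $|\cdot|:\mathbb{K}\to[0,\infty)$ such that $|x|=0$ iff $x=0$, $|xy|=|x||y|$, and $|x+y|\leq\max\{|x|,|y|\}$ for all $x,y\in\mathbb{K}$. $\mathbb{M}_n(\mathbb{K})$ denotes the set of $n\times n$ matrices over $\mathbb{K}$. $\sigma(A)$ is the set of all eigenvalues of $A$, i.e. the $\lambda\in\mathbb{K}$ with $A\mathbf{x}=\lambda\mathbf{x}$ for some nonzero $\mathbf{x}\in\mathbb{K}^n$. For $A=[a_{j,k}]_{1\leq j\leq n,\,1\leq k\leq n}\in\mathbb{M}_n(\mathbb{K})$, define $h_j(A)=\max_{1\leq k\leq n,\,k\neq j}|a_{j,k}|$ for $1\leq j\leq n$ and $v_k(A)=\max_{1\leq j\leq n,\,j\neq k}|a_{j,k}|$ for $1\leq k\leq n$. *)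

(* Defs.v *)
From HB Require Import structures.
From mathcomp Require Import all_boot all_order all_algebra.
From mathcomp Require Import classical_sets reals.

Set Implicit Arguments.
Unset Strict Implicit.
Unset Printing Implicit Defensive.

Import Order.TTheory GRing.Theory Num.Theory.
Local Open Scope classical_set_scope.
Local Open Scope ring_scope.

Definition nonarchimedean_valuation (R : realType) (K : fieldType)
    (v : K -> R) : Prop :=
  [/\ forall x, 0 <= v x,
      forall x, v x = 0 <-> x = 0,
      forall x y, v (x * y) = v x * v y
    & forall x y, v (x + y) <= Num.max (v x) (v y)].

(* Right eigenvalues, on column vectors; [eigenvalue] in mxalgebra is about row
   vectors. *)
Definition spectrum (K : fieldType) (n : nat) (A : 'M[K]_n) : set K :=
  [set lam | exists2 x : 'cV[K]_n, x != 0 & A *m x = lam *: x].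

(* The maxima below are over nonempty families when 1 < n; since v takes
   nonnegative values, the initial value 0 then does not affect them. *)
Definition row_max (R : realType) (K : fieldType) (v : K -> R) (n : nat)
    (A : 'M[K]_n) (j : 'I_n) : R :=
  \big[Num.max/0]_(k < n | k != j) v (A j k).

Definition col_max (R : realType) (K : fieldType) (v : K -> R) (n : nat)
    (A : 'M[K]_n) (k : 'I_n) : R :=
  \big[Num.max/0]_(j < n | j != k) v (A j k).

(* Main.v *)
Require Import Defs.
From HB Require Import structures.
From mathcomp Require Import all_boot all_order all_algebra.
From mathcomp Require Import classical_sets reals.

Set Implicit Arguments.
Unset Strict Implicit.
Unset Printing Implicit Defensive.

Import Order.TTheory GRing.Theory Num.Theory.
Local Open Scope classical_set_scope.
Local Open Scope ring_scope.

(** Row by row, an eigenvector [x] for [lam] satisfies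
    (lam - a_ii) x_i = sum_(k != i) a_ik x_k.
    Let [p] be an index where |x_p| is largest and [q] an index where |x_k| is
    largest among k != p.  The ultrametric inequality gives
    |lam - a_pp| |x_p| <= h_p |x_q|   and   |lam - a_qq| |x_q| <= h_q |x_p|,
    the second because p itself competes in row q.  Multiplying and cancelling
    |x_p| |x_q| yields the row inclusion; if x_q = 0 there is nothing to cancel,
    but then the first bound forces lam = a_pp and the left-hand side vanishes
    ([spectrum_sub_row_ovals]).

    The column inclusion is the row inclusion for the transpose of A, which has
    the same eigenvalues since lam I - A and its transpose have the same
    determinant ([spectrum_trmx]). *)

Lemma valuation_sum_le (R : realType) (K : fieldType) (v : K -> R)
    (hv : nonarchimedean_valuation v) (I : finType) (P : pred I) (F : I -> K)
    (M : R) :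
  0 <= M -> (forall i, P i -> v (F i) <= M) -> v (\sum_(i | P i) F i) <= M.
Proof.
case: hv => _ v_eq0 _ vD M0 leFM.
apply: (big_ind (fun z => v z <= M)) => // [|a b leaM lebM].
  by rewrite (v_eq0 0).2.
by apply: le_trans (vD a b) _; rewrite ge_max leaM.
Qed.

Lemma valuation_le_row_max (R : realType) (K : fieldType) (v : K -> R) (n : nat)
    (A : 'M[K]_n) (i k : 'I_n) :
  k != i -> v (A i k) <= row_max v A i.
Proof. by move=> ki; apply: (le_bigmax_cond _ (fun k => v (A i k))). Qed.

Lemma row_max_ge0 (R : realType) (K : fieldType) (v : K -> R) (n : nat)
    (A : 'M[K]_n) (i : 'I_n) :
  0 <= row_max v A i.
Proof. exact: bigmax_ge_id. Qed.

Lemma row_max_trmx (R : realType) (K : fieldType) (v : K -> R) (n : nat)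
    (A : 'M[K]_n) (i : 'I_n) :
  row_max v A^T i = col_max v A i.
Proof. by apply: eq_bigr => k _; rewrite mxE. Qed.

(** The ultrametric form of the Gershgorin row estimate: the diagonal term of
    row [i] is isolated in the eigenvalue equation, and what remains is a sum
    over the other columns, hence no larger than its largest term. *)
Lemma eigenvector_row_le (R : realType) (K : fieldType) (v : K -> R)
    (hv : nonarchimedean_valuation v) (n : nat) (A : 'M[K]_n) (lam : K)
    (x : 'cV[K]_n) (i : 'I_n) (M : R) :
  A *m x = lam *: x -> 0 <= M -> (forall k, k != i -> v (x k 0) <= M) ->
  v (lam - A i i) * v (x i 0) <= row_max v A i * M.
Proof.
move=> Ax M0 lexM; have [v_ge0 _ vM _] := hv.
have rowi : (lam - A i i) * x i 0 = \sum_(k < n | k != i) A i k * x k 0.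
  have /matrixP/(_ i 0) := Ax; rewrite !mxE (bigD1 i) //= => Axi.
  by rewrite mulrBl -Axi addrAC subrr add0r.
rewrite -vM rowi; apply: valuation_sum_le => // [|k ki].
  by rewrite mulr_ge0 // row_max_ge0.
by rewrite vM ler_pM // ?valuation_le_row_max // lexM.
Qed.

(** Left and right eigenvectors belong to the same eigenvalues, as both exist
    exactly when the characteristic determinant vanishes. *)
Lemma spectrum_trmx (K : fieldType) (n : nat) (A : 'M[K]_n) :
  spectrum A `<=` spectrum A^T.
Proof.
move=> lam [x x0 Ax].
have /det0P[y y0 yA] : \det (A - lam%:M) == 0.
  rewrite -det_tr; apply/det0P; exists x^T; first by rewrite trmx_eq0.
  by rewrite -trmx_mul mulmxBl mul_scalar_mx Ax subrr trmx0.
exists y^T; first by rewrite trmx_eq0.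
move/eqP: yA; rewrite mulmxBr mul_mx_scalar subr_eq0 => /eqP yA.
by rewrite -trmx_mul yA linearZ.
Qed.

(** Taking [p], [q] at the two largest entries of an eigenvector makes the two
    row estimates reciprocal, so that the entries cancel in their product. *)
Lemma spectrum_sub_row_ovals (R : realType) (K : fieldType) (v : K -> R)
    (hv : nonarchimedean_valuation v) (n : nat) (hn : (1 < n)%N)
    (A : 'M[K]_n) :
  spectrum A `<=`
     \bigcup_(jk in [set jk : 'I_n * 'I_n | jk.1 != jk.2])
       [set z : K | v (z - A jk.1 jk.1) * v (z - A jk.2 jk.2)
                    <= row_max v A jk.1 * row_max v A jk.2].
Proof.
have [v_ge0 v_eq0 _ _] := hv.
move=> lam [x x0 Ax].
have [p _ xp_max] : extremum_spec >=%O predT (fun i => v (x i 0))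
    [arg max_(i > Ordinal (ltnW hn)) v (x i 0)]%O by exact: arg_maxP.
have [q0 q0p] : exists q, q != p.
  have /card_gt0P[q] : (0 < #|predC1 p|)%N.
    by rewrite cardC1 card_ord ltn_predRL.
  by rewrite inE; exists q.
have [q qp xq_max] : extremum_spec >=%O (fun i => i != p) (fun i => v (x i 0))
    [arg max_(i > q0 | i != p) v (x i 0)]%O by exact: arg_maxP.
have xp_gt0 : 0 < v (x p 0).
  rewrite lt_neqAle v_ge0 andbT; apply: contra_neq x0 => xp0.
  apply/matrixP => i j; rewrite ord1 mxE; apply/v_eq0/le_anti.
  by rewrite v_ge0 andbT xp0; apply: xp_max.
have lep := eigenvector_row_le hv Ax (v_ge0 _) xq_max.
have leq : v (lam - A q q) * v (x q 0) <= row_max v A q * v (x p 0).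
  by apply: eigenvector_row_le => // k _; apply: xp_max.
exists (p, q) => /=; first by rewrite eq_sym.
have [xq0|xq_neq0] := eqVneq (v (x q 0)) 0.
  have -> : v (lam - A p p) = 0.
    apply/le_anti; rewrite v_ge0 andbT.
    by move: lep; rewrite xq0 mulr0 pmulr_lle0.
  by rewrite mul0r mulr_ge0 // row_max_ge0.
have xq_gt0 : 0 < v (x q 0) by rewrite lt_neqAle eq_sym xq_neq0 v_ge0.
rewrite -(ler_pM2r (mulr_gt0 xp_gt0 xq_gt0)) mulrACA.
rewrite [v (x p 0) * _ in leRHS]mulrC [leRHS]mulrACA.
by apply: ler_pM => //; apply: mulr_ge0.
Qed.

Theorem theorem2p1 (R : realType) (K : fieldType) (v : K -> R)
    (hv : nonarchimedean_valuation v) (n : nat) (hn : (1 < n)%N)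
    (A : 'M[K]_n) :
  (spectrum A `<=`
     \bigcup_(jk in [set jk : 'I_n * 'I_n | jk.1 != jk.2])
       [set z : K | v (z - A jk.1 jk.1) * v (z - A jk.2 jk.2)
                    <= row_max v A jk.1 * row_max v A jk.2])
  /\
  (spectrum A `<=`
     \bigcup_(jk in [set jk : 'I_n * 'I_n | jk.1 != jk.2])
       [set z : K | v (z - A jk.1 jk.1) * v (z - A jk.2 jk.2)
                    <= col_max v A jk.1 * col_max v A jk.2]).
Proof.
split; first exact: spectrum_sub_row_ovals.
move=> lam /spectrum_trmx/(spectrum_sub_row_ovals hv hn)[[j k] /= jk].
rewrite !row_max_trmx !mxE => le_jk.
by exists (j, k).
Qed.
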